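(* Let $G=(V,E)$ be a graph. For every hypersphere representation of $G$ with squared radius $t$ and every nonzero $x \in \mathrm{TH}(\overline{G})$, we have $$2t + \frac{1}{\bar e^{T}x} \ge 1,$$ with equality if and only if $t = t(G)$ and $\bar e^{T}x = \vartheta(\overline{G})$.
   Context: Graphs are finite and simple with nonempty vertex set; $\overline{G}$ is the complement of $G$. $\bar e$ is the all-ones vector. A unit-distance representation of $G=(V,E)$ is a function $u: V\to\mathbb{R}^d$ for some $d\ge 1$ with $\|u(i)-u(j)\|=1$ (Euclidean norm) whenever $\{i,j\}\in E$. A hypersphere representation of $G$ is a unit-distance representation of $G$ whose image is contained in a hypersphere centered at the origin (radius $r\ge 0$, radius $0$ allowed); its squared radius is $r^2$. The hypersphere number $t(G)$ is the minimum squared radius of a hypersphere representation of $G$; equivalently, the minimum $t\in\mathbb{R}$ such that there is a positive semidefinite symmetric $V\times V$ matrix $X$ with $X_{ii}=t$ for all $i\in V$ and $X_{ii}-2X_{ij}+X_{jj}=1$ for all $\{i,j\}\in E$. The theta number of a graph $H=(V,F)$ is $\vartheta(H)=\max\{\bar e^{T}X\bar e : \mathrm{Tr}(X)=1,\ X_{ij}=0\ \forall\{i,j\}\in F,\ X \text{ symmetric positive semidefinite } V\times V\}$. An orthonormal representation of a graph $H=(V,F)$ is a function $p$ from $V$ to the unit sphere in $\mathbb{R}^d$, for some $d\ge1$, mapping distinct non-adjacent nodes of $H$ to orthogonal vectors. $\mathrm{TH}(H)$ is the set of all $x\in\mathbb{R}^V$ with nonnegative entries such that $\sum_{i\in V}(c^{T}p(i))^2x_i\le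 1$ for every orthonormal representation $p:V\to\mathbb{R}^d$ of $H$ and every unit vector $c\in\mathbb{R}^d$. *)

(* Defs.v *)
From HB Require Import structures.
From mathcomp Require Import all_boot all_order all_algebra.
From mathcomp Require Import boolp classical_sets reals.
From mathcomp Require Import ring.

Set Implicit Arguments.
Unset Strict Implicit.
Unset Printing Implicit Defensive.

Import Order.TTheory GRing.Theory Num.Theory.
Local Open Scope classical_set_scope.
Local Open Scope ring_scope.

Definition dotv (R : realType) (d : nat) (u v : 'rV[R]_d) : R :=
  \sum_(k < d) u 0 k * v 0 k.

(* MathComp-Analysis equips 'rV[R]_d with the sup norm, hence a separate
   Euclidean norm. *)
Definition enorm (R : realType) (d : nat) (u : 'rV[R]_d) : R :=
  Num.sqrt (dotv u u).

(* A simple graph on T is a symmetric and irreflexive relation. *)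
Definition compl_graph (T : finType) (e : rel T) : rel T :=
  [rel i j | (i != j) && ~~ e i j].

Definition unit_distance_rep (R : realType) (T : finType) (e : rel T) (d : nat)
    (u : T -> 'rV[R]_d) : Prop :=
  (0 < d)%N /\ forall i j : T, e i j -> enorm (u i - u j) = 1.

Definition hypersphere_rep (R : realType) (T : finType) (e : rel T) (d : nat)
    (u : T -> 'rV[R]_d) (t : R) : Prop :=
  unit_distance_rep e u /\
  exists r : R, [/\ 0 <= r, forall i : T, enorm (u i) = r & t = r ^+ 2].

Definition hypersphere_sqradii (R : realType) (T : finType) (e : rel T)
    : set R :=
  [set t | exists (d : nat) (u : T -> 'rV[R]_d), hypersphere_rep e u t].
Arguments hypersphere_sqradii R {T} e.

(* The minimum squared radius. The infimum is never a junk value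
   (has_inf_hypersphere_sqradii) and equals the minimum
   (hypersphere_number_min). *)
Definition hypersphere_number (R : realType) (T : finType) (e : rel T) : R :=
  inf (hypersphere_sqradii R e).
Arguments hypersphere_number R {T} e.

Definition psdmx (R : realType) (n : nat) (X : 'M[R]_n) : Prop :=
  X^T = X /\ forall v : 'cV[R]_n, 0 <= (v^T *m X *m v) 0 0.

Definition ones (R : realType) (n : nat) : 'cV[R]_n := const_mx 1.

(* V x V matrices are indexed by 'I_#|T| through enum_rank : T -> 'I_#|T|. *)
Definition theta_feasible (R : realType) (T : finType) (f : rel T)
    (X : 'M[R]_#|T|) : Prop :=
  [/\ psdmx X, \tr X = 1 &
      forall i j : T, f i j -> X (enum_rank i) (enum_rank j) = 0].

Definition theta_values (R : realType) (T : finType) (f : rel T) : set R :=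
  [set s | exists2 X : 'M[R]_#|T|, theta_feasible f X &
     s = ((ones R #|T|)^T *m X *m ones R #|T|) 0 0].
Arguments theta_values R {T} f.

(* The maximum of e^T X e. The supremum is never a junk value
   (has_sup_theta_values) and equals the maximum (theta_max). *)
Definition theta (R : realType) (T : finType) (f : rel T) : R :=
  sup (theta_values R f).
Arguments theta R {T} f.

Definition orthonormal_rep (R : realType) (T : finType) (f : rel T) (d : nat)
    (p : T -> 'rV[R]_d) : Prop :=
  [/\ (0 < d)%N, forall i : T, enorm (p i) = 1 &
      forall i j : T, i != j -> ~~ f i j -> dotv (p i) (p j) = 0].

Definition TH (R : realType) (T : finType) (f : rel T) : set {ffun T -> R} :=
  [set x | (forall i : T, 0 <= x i) /\
     forall (d : nat) (p : T -> 'rV[R]_d) (c : 'rV[R]_d),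
       orthonormal_rep f p -> enorm c = 1 ->
       \sum_(i : T) dotv c (p i) ^+ 2 * x i <= 1].

Lemma hypersphere_number_min (R : realType) (T : finType) (e : rel T) (m : R) :
  hypersphere_sqradii R e m ->
  (forall t, hypersphere_sqradii R e t -> m <= t) ->
  hypersphere_number R e = m.
Proof.
move=> Sm lbm; apply/eqP; rewrite eq_le; apply/andP; split.
  by apply: ge_inf => //; exists m.
by apply: lb_le_inf => //; exists m.
Qed.

Lemma theta_max (R : realType) (T : finType) (f : rel T) (m : R) :
  theta_values R f m -> (forall s, theta_values R f s -> s <= m) ->
  theta R f = m.
Proof.
move=> Sm ubm; apply/eqP; rewrite eq_le; apply/andP; split.
  by apply: ge_sup => //; exists m.
by apply: ub_le_sup => //; exists m.
Qed.

Lemma has_inf_hypersphere_sqradii (R : realType) (T : finType) (e : rel T) :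
  irreflexive e -> (0 < #|T|)%N -> has_inf (hypersphere_sqradii R e).
Proof.
move=> eirr T0; split; last first.
  by exists 0 => _ [d [u [_ [r [_ _ ->]]]]]; exact: sqr_ge0.
pose a : R := Num.sqrt 2^-1.
have a2 : a ^+ 2 = 2^-1 by rewrite sqr_sqrtr // invr_ge0 ler0n.
have dele (i : T) k : (a *: delta_mx 0 (enum_rank i) : 'rV[R]_#|T|) 0 k =
    a * (k == enum_rank i)%:R by rewrite !mxE eqxx.
exists (a ^+ 2), #|T|, (fun i => a *: delta_mx 0 (enum_rank i)); split.
  split=> // i j eij; have neq : i != j.
    by apply: contraTneq eij => ->; rewrite eirr.
  have neq' : (enum_rank j == enum_rank i) = false.
    by rewrite (inj_eq enum_rank_inj) eq_sym (negbTE neq).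
  rewrite /enorm /dotv (bigD1 (enum_rank i)) //= (bigD1 (enum_rank j)) ?neq' //=.
  rewrite big1 => [|k /andP[ki kj]].
    rewrite !mxE !eqxx neq' eq_sym neq' /= !mulr1 !mulr0 subr0 sub0r mulrNN.
    rewrite -expr2 a2 addr0.
    by rewrite -[RHS]sqrtr1 [in RHS](splitr 1) !mul1r.
  by rewrite !mxE (negbTE ki) (negbTE kj) !andbF !mulr0 subrr mul0r.
exists a; split=> // [|i]; first exact: sqrtr_ge0.
rewrite /enorm /dotv (bigD1 (enum_rank i)) //= big1 => [|k ki].
  by rewrite addr0 dele eqxx mulr1 -expr2 sqrtr_sqr ger0_norm // sqrtr_ge0.
by rewrite dele (negbTE ki) !mulr0.
Qed.

Lemma quad_formE (R : realType) (n : nat) (X : 'M[R]_n) (v : 'cV[R]_n) :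
  (v^T *m X *m v) 0 0 = \sum_i \sum_j v i 0 * X i j * v j 0.
Proof.
rewrite mxE exchange_big /=; apply: eq_bigr => j _.
by rewrite mxE mulr_suml; apply: eq_bigr => i _; rewrite mxE.
Qed.

Lemma has_sup_theta_values (R : realType) (T : finType) (f : rel T) :
  irreflexive f -> (0 < #|T|)%N -> has_sup (theta_values R f).
Proof.
move=> firr T0; have n0 : (#|T|%:R : R) != 0 by rewrite pnatr_eq0 -lt0n.
split.
  pose X : 'M[R]_#|T| := (#|T|%:R^-1)%:M.
  eexists; exists X => //; split.
  - split; first by rewrite tr_scalar_mx.
    move=> v; rewrite mul_mx_scalar -scalemxAl mxE mulr_ge0 ?invr_ge0 //.
    rewrite mxE sumr_ge0 // => i _; rewrite mxE -expr2; exact: sqr_ge0.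
  - by rewrite mxtrace_scalar -[LHS]mulr_natr mulVf.
  - move=> i j fij; rewrite mxE (inj_eq enum_rank_inj).
    by case: eqP fij => // ->; rewrite firr.
exists #|T|%:R => _ [X [[Xs Xp] trX _] ->].
have key i j : X i j + X i j <= X i i + X j j.
  have Xji : X j i = X i j by rewrite -[in LHS]Xs mxE.
  have := Xp (delta_mx i 0 - delta_mx j 0).
  rewrite [(_ - _)^T]linearB /= !trmx_delta !mulmxBl !mulmxBr -!rowE.
  rewrite -!colE !mxE Xji => h.
  by rewrite -subr_ge0; apply: le_trans h _; rewrite le_eqVlt; apply/orP; left;
    apply/eqP; ring.
rewrite quad_formE.
under eq_bigr do under eq_bigr do rewrite !mxE mul1r mulr1.
rewrite -(ler_pMn2r (n := 2)) // !mulr2n -big_split /=.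
under eq_bigr do rewrite -big_split /=.
apply: (@le_trans _ _ (\sum_i \sum_j (X i i + X j j))).
  by apply: ler_sum => i _; apply: ler_sum => j _.
under eq_bigr do rewrite big_split /= sumr_const card_ord.
by rewrite big_split /= sumrMnl sumr_const card_ord -/(\tr X) trX.
Qed.

(* Main.v *)
Require Import Defs.
From mathcomp Require Import all_boot all_order all_algebra.
From mathcomp Require Import boolp classical_sets reals.
From mathcomp Require Import topology normedtype derive.
From mathcomp Require Import ring lra.
Import Order.TTheory GRing.Theory Num.Theory.
Import numFieldNormedType.Exports.
Local Open Scope classical_set_scope.
Local Open Scope ring_scope.
Set Implicit Arguments.
Unset Strict Implicit.
Unset Printing Implicit Defensive.

(** Lifting turns a hypersphere representation [u] of squared radius
    [t < 1/2] into an orthonormal representation of the complement: put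
    [p i = (sqrt 2 u_i, sqrt (1 - 2 t))].  Adjacent nodes satisfy
    [u_i . u_j = t - 1/2], so they receive orthogonal vectors, and the last
    basis vector [c] has [(c . p i)^2 = 1 - 2 t] for every [i].  The
    inequality of [TH] for this [p] and [c] is [(1 - 2 t) e^T x <= 1]
    ([TH_sum_bound]), which is the inequality of the theorem.

    The case of equality rests on the strong duality
    [2 t(G) + 1 / theta = 1], where theta is taken on the complement of [G].
    Pairing the Gram matrix of [u] with a matrix feasible for theta gives
    [(1 - 2 t) s <= 1] for every theta value [s] ([theta_feasible_bound]).
    Conversely, a hypersphere representation with [2 t + 1 / theta = 1] exists
    ([optimal_hypersphere_rep]): up to the factor [1 / (2 theta)] its Gram
    matrix has to agree with [theta I - J] on the diagonal and on the edges.
    By [psd_completion_alternative], if no Gram matrix has these entries, there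
    is a positive semidefinite [W], vanishing outside the diagonal and the
    edges, with [<W, theta I - J> < 0], i.e. [theta * tr W < e^T W e];
    normalizing [W] to trace 1 would then give a theta value above theta.

    The alternative is the separation of a point from a closed convex cone,
    obtained by least squares: among all [U], minimize the squared deviation
    of the prescribed entries of [U U^T].  If the minimum is not zero, the
    residual matrix at the minimizer is the separating [W].

    Given all this, if [2 t + 1 / e^T x = 1] then [t] is minimal because the
    inequality holds for all representations with the same [x]; the two
    duality bounds squeeze [e^T x] to theta.  Conversely, [t = t(G)] is at most
    the squared radius of the optimal representation. *)

(** * Least-squares fit of prescribed Gram matrix entries *)

Definition gram_residual (R : realType) (n m : nat) (S : rel 'I_n)
    (b : 'M[R]_n) (U : 'M[R]_(n, m)) : R :=
  \sum_(p : 'I_n * 'I_n | S p.1 p.2)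
    ((U *m U^T) p.1 p.2 - b p.1 p.2) ^+ 2.

Lemma gram_residual_continuous (R : realType) (X : topologicalType)
    (n m : nat) (S : rel 'I_n) (b : 'M[R]_n) (U : X -> 'M[R]_(n, m)) :
  (forall i k, continuous (fun x => U x i k)) ->
  continuous (fun x => gram_residual S b (U x)).
Proof.
move=> cU.
have sum_continuous (I : Type) (r : seq I) (P : pred I)
    (F : I -> X -> R) : (forall i, P i -> continuous (F i)) ->
    continuous (fun v => \sum_(i <- r | P i) F i v).
  move=> cF.
  exact: (@continuous_big R I +%R 0 P (@add_continuous R) _ _ _ cF).
apply: (sum_continuous _ _ _ (fun p v => _)) => p _.
have cf : continuous (fun x => (U x *m (U x)^T) p.1 p.2 - b p.1 p.2).
  move=> v; apply: cvgB; last exact: cvg_cst.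
  have -> : (fun x => (U x *m (U x)^T) p.1 p.2) =
      fun x => \sum_k U x p.1 k * U x p.2 k.
    by apply/funext => x; rewrite mxE; apply: eq_bigr => k _; rewrite mxE.
  rewrite mxE; under eq_bigr do rewrite mxE.
  apply: (sum_continuous _ _ _ (fun k x => U x p.1 k * U x p.2 k)) => k _ y.
  by apply: cvgM; exact: cU.
by under eq_fun do rewrite expr2; move=> v; apply: cvgM; exact: cf.
Qed.

(** The prescribed diagonal controls the norms of the rows of [U], hence all
    its entries; this is what makes minimizing over a box enough. *)
Lemma gram_residual_coercive (R : realType) (n m : nat) (S : rel 'I_n)
    (b : 'M[R]_n) : reflexive S ->
  exists2 B : R, 0 <= B & forall U : 'M[R]_(n, m),
    gram_residual S b U <= gram_residual S b (0 : 'M_(n, m)) ->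
    forall i k, `|U i k| <= B.
Proof.
move=> Srefl; set r0 := gram_residual S b 0.
have r0_ge0 : 0 <= r0 by apply: sumr_ge0 => p _; exact: sqr_ge0.
pose s := \sum_i `|b i i|.
have s_ge0 : 0 <= s by apply: sumr_ge0.
(* an entry above this bound makes the deviation on the diagonal exceed
   [r0]: its square is at least [1 + s + r0], and [b i i <= s] *)
exists (1 + s + r0) => [|U rU i k]; first lra.
rewrite leNgt; apply/negP => ltB.
have gii : (1 + s + r0) < (U *m U^T) i i.
  have sqB : 1 + s + r0 < U i k ^+ 2 by rewrite -real_normK ?num_real //; nra.
  apply: lt_le_trans sqB _.
  rewrite mxE (bigD1 k) //= mxE -expr2 lerDl; apply: sumr_ge0 => j _.
  by rewrite mxE -expr2 sqr_ge0.
have bii : b i i <= s.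
  apply: le_trans (ler_norm _) _; rewrite /s (bigD1 i) //= lerDl.
  exact: sumr_ge0.
have : ((U *m U^T) i i - b i i) ^+ 2 <= gram_residual S b U.
  rewrite /gram_residual (bigD1 (i, i)) /= ?Srefl // lerDl.
  by apply: sumr_ge0 => p _; exact: sqr_ge0.
by move: gii; set g := (_ *m _) i i; nra.
Qed.

Lemma gram_residual_minimizer (R : realType) (n m : nat) (S : rel 'I_n)
    (b : 'M[R]_n) : reflexive S ->
  exists U0 : 'M[R]_(n, m), forall U : 'M[R]_(n, m),
    gram_residual S b U0 <= gram_residual S b U.
Proof.
move=> Srefl; have [B B0 coerB] := @gram_residual_coercive R n m S b Srefl.
pose K := [set v : 'rV[R]_(n * m) | forall i, `[- B, B]%classic (v ord0 i)].
have K0 : K 0 by move=> i /=; rewrite mxE in_itv /= oppr_le0 B0.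
have cK : compact K.
  apply: (@rV_compact _ _ (fun=> `[- B, B]%classic)) => _.
  exact: segment_compact.
have [] := EVT_min_rV (ex_intro _ _ K0) cK
    (f := fun v => gram_residual S b (vec_mx v)).
  apply: continuous_subspaceT; apply: gram_residual_continuous => i k.
  have -> : (fun v : 'rV[R]_(n * m) => vec_mx v i k) =
      fun v => v 0 (mxvec_index i k) by apply/funext => v; rewrite mxE.
  exact: coord_continuous.
move=> c _ cmin; exists (vec_mx c) => U.
have [le0|/ltW lt0] :=
  leP (gram_residual S b U) (gram_residual S b (0 : 'M_(n, m))).
  rewrite -(mxvecK U); apply: cmin; rewrite inE => l.
  case/mxvec_indexP: l => i k /=; rewrite mxvecE in_itv /= -ler_norml.
  exact: coerB.
(* here 0 does better than [U], and 0 is in the box *)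
apply: le_trans lt0; rewrite -[0 : 'M_(n, m)](linear0 vec_mx).
by apply: cmin; rewrite inE.
Qed.

(** * Theorem of alternatives for positive semidefinite completion *)

(** The first-order condition at an end point of an interval. *)
Lemma quadratic_min_slope_ge0 (R : realType) (a c : R) :
  0 <= c -> (forall s, 0 <= s <= 1 -> 0 <= 2 * s * a + s ^+ 2 * c) -> 0 <= a.
Proof.
move=> c0 h; rewrite leNgt; apply/negP => a0.
have dgt : 0 < c + 1 - a by lra.
have dn : c + 1 - a != 0 by apply: lt0r_neq0.
(* [- a / c] minimizes the quadratic; the denominator is enlarged to keep
   [s] in [[0, 1]] and to allow [c = 0] *)
pose s := - a / (c + 1 - a).
have s0 : 0 < s by rewrite divr_gt0 // oppr_gt0.
have sd : s * (c + 1 - a) = - a by rewrite /s divfK.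
have s1 : s <= 1 by rewrite /s ler_pdivrMr // mul1r; lra.
have := h s; rewrite (ltW s0) s1 => /(_ isT).
nra.
Qed.

(** The matrix [W] is the residual at a least-squares minimizer [U].  If
    [U U^T] can be moved a little in a direction [D] inside the Gram matrices,
    then [<W, D> >= 0].  The directions [U U^T] and [- U U^T], available by
    rescaling [U], give [<W, U U^T> = 0], hence
    [<W, b> = - |W|^2 < 0]; the directions [v v^T] say that [W] is positive
    semidefinite.  The extra column of [U] ensures that [U] has a kernel vector
    [w], and then [v v^T] is added by replacing [U] with [U + c v w^T], the
    cross terms being zero. *)
Lemma psd_completion_alternative (R : realType) (n : nat) (S : rel 'I_n)
    (b : 'M[R]_n) : symmetric S -> reflexive S -> b^T = b ->
  (exists U : 'M[R]_(n, n.+1), forall i j, S i j -> (U *m U^T) i j = b i j) \/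
  (exists W : 'M[R]_n, [/\ psdmx W, forall i j, ~~ S i j -> W i j = 0 &
     \sum_i \sum_j W i j * b i j < 0]).
Proof.
move=> Ssym Srefl bsym.
have [U Umin] := @gram_residual_minimizer R n n.+1 S b Srefl.
pose Z := U *m U^T.
pose W : 'M[R]_n := \matrix_(i, j) if S i j then Z i j - b i j else 0.
have Zsym i j : Z j i = Z i j.
  by rewrite !mxE; apply: eq_bigr => k _; rewrite !mxE mulrC.
have [res0|resN0] := eqVneq (gram_residual S b U) 0.
  left; exists U => i j Sij; apply/eqP; rewrite -subr_eq0 -sqrf_eq0.
  by move/eqP: res0; rewrite psumr_eq0 => [/allP/(_ (i, j) (mem_index_enum _)) |
    p _]; [rewrite /= Sij | exact: sqr_ge0].
right; exists W.
pose dot (A : 'M[R]_n) := \sum_(p : 'I_n * 'I_n) W p.1 p.2 * A p.1 p.2.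
have dotE A : dot A =
    \sum_(p : 'I_n * 'I_n | S p.1 p.2) (Z p.1 p.2 - b p.1 p.2) * A p.1 p.2.
  rewrite [RHS]big_mkcond; apply: eq_bigr => p _; rewrite mxE.
  by case: ifP; rewrite ?mul0r.
have slope (D : 'M[R]_n) : (forall s, 0 <= s <= 1 ->
    exists V : 'M[R]_(n, n.+1), V *m V^T = Z + s *: D) -> 0 <= dot D.
  move=> realiz.
  apply: (@quadratic_min_slope_ge0 _ _
    (\sum_(p : 'I_n * 'I_n | S p.1 p.2) D p.1 p.2 ^+ 2)).
    by apply: sumr_ge0 => p _; exact: sqr_ge0.
  move=> s /realiz[V VE]; have := Umin V; rewrite -subr_ge0.
  rewrite /gram_residual VE -/Z -sumrB dotE !mulr_sumr -big_split /=.
  by congr (_ <= _); apply: eq_bigr => p _; rewrite !mxE; ring.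
have dotZ : dot Z = 0.
  have scaleU s : 0 <= 1 + s ->
      exists V : 'M[R]_(n, n.+1), V *m V^T = Z + s *: Z.
    move=> s0; exists (Num.sqrt (1 + s) *: U).
    rewrite linearZ /= -scalemxAl -scalemxAr scalerA -expr2 sqr_sqrtr //.
    by rewrite scalerDl scale1r.
  apply/eqP; rewrite eq_le; apply/andP; split.
    suff : 0 <= dot (- Z).
      rewrite /dot -oppr_ge0 -sumrN; congr (_ <= _).
      by apply: eq_bigr => p _; rewrite !mxE mulrN.
    apply: slope => s /andP[s0 s1]; have [|V VE] := scaleU (- s); first lra.
    by exists V; rewrite VE scalerN scaleNr.
  apply: slope => s /andP[s0 s1]; apply: scaleU; lra.
split.
- split.
    apply/matrixP => i j; rewrite mxE [LHS]mxE [RHS]mxE Ssym Zsym.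
    by have := congr1 (fun M : 'M_n => M i j) bsym; rewrite /= mxE => ->.
  move=> v.
  have [w wN0 Uw] : exists2 w : 'cV[R]_n.+1, w != 0 & U *m w = 0.
    have : kermx U^T != 0.
      rewrite -mxrank_eq0 mxrank_ker mxrank_tr -lt0n subn_gt0 ltnS.
      exact: rank_leq_row.
    case/rowV0Pn => w /sub_kermxP wU wN0; exists w^T.
      by rewrite -trmx0 (inj_eq trmx_inj).
    by apply: trmx_inj; rewrite trmx_mul trmxK wU trmx0.
  pose q := (w^T *m w) 0 0.
  have q0 : 0 < q.
    have qE : q = \sum_k w k 0 ^+ 2.
      by rewrite /q mxE; apply: eq_bigr => k _; rewrite mxE expr2.
    rewrite lt_def qE sumr_ge0 ?andbT => [|k _]; last exact: sqr_ge0.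
    apply: contra wN0.
    rewrite psumr_eq0 => [/allP all0|k _]; last exact: sqr_ge0.
    apply/eqP/matrixP => k l; rewrite ord1 mxE.
    by apply/eqP; rewrite -sqrf_eq0; apply: all0; exact: mem_index_enum.
  have : 0 <= dot (q *: (v *m v^T)).
    apply: slope => s /andP[s0 _].
    exists (U + Num.sqrt s *: (v *m w^T)).
    rewrite linearD /= linearZ /= trmx_mul trmxK mulmxDl !mulmxDr -/Z.
    rewrite -!scalemxAl -!scalemxAr !mulmxA Uw mul0mx scaler0 addr0.
    rewrite -(mulmxA v w^T U^T) -trmx_mul Uw trmx0 mulmx0 scaler0 add0r.
    rewrite scalerA -expr2 sqr_sqrtr // -(mulmxA v w^T w).
    by rewrite (mx11_scalar (w^T *m w)) -/q mul_mx_scalar -scalemxAl.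
  have -> : dot (q *: (v *m v^T)) = q * (v^T *m W *m v) 0 0.
    rewrite quad_formE pair_big mulr_sumr /=; apply: eq_bigr => p _.
    rewrite [X in _ * X]mxE [X in _ * (q * X)]mxE big_ord1 [v^T _ _]mxE.
    by rewrite mulrCA [X in q * X = _]mulrCA mulrA.
  by rewrite pmulr_rge0.
- by move=> i j /negbTE Sij; rewrite mxE Sij.
- rewrite pair_big /= -/(dot b).
  have dotB : dot Z - dot b = gram_residual S b U.
    rewrite !dotE -sumrB; apply: eq_bigr => p _.
    by rewrite -mulrBr -expr2.
  rewrite -oppr_gt0 -sub0r -[X in X - _]dotZ dotB lt_def resN0.
  by apply: sumr_ge0 => p _; exact: sqr_ge0.
Qed.

(** * Hypersphere representations through inner products *)

Lemma enorm_sqr (R : realType) (d : nat) (a : 'rV[R]_d) :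
  enorm a ^+ 2 = dotv a a.
Proof.
by rewrite sqr_sqrtr //; apply: sumr_ge0 => k _; rewrite -expr2 sqr_ge0.
Qed.

Lemma dotvZ (R : realType) (d : nat) (s : R) (a b : 'rV[R]_d) :
  dotv (s *: a) (s *: b) = s ^+ 2 * dotv a b.
Proof.
by rewrite /dotv mulr_sumr; apply: eq_bigr => k _; rewrite !mxE; ring.
Qed.

Lemma dotv_row_mx (R : realType) (m n : nat)
    (a b : 'rV[R]_m) (a' b' : 'rV[R]_n) :
  dotv (row_mx a a') (row_mx b b') = dotv a b + dotv a' b'.
Proof.
rewrite /dotv big_split_ord /=; congr (_ + _); apply: eq_bigr => k _.
  by rewrite !row_mxEl.
by rewrite !row_mxEr.
Qed.

Lemma dotv_subsub (R : realType) (d : nat) (a b : 'rV[R]_d) :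
  dotv (a - b) (a - b) = dotv a a + dotv b b - 2 * dotv a b.
Proof.
rewrite /dotv mulr_sumr -big_split -sumrB /=.
by apply: eq_bigr => k _; rewrite !mxE; ring.
Qed.

Lemma dotv_row (R : realType) (m n : nat) (U : 'M[R]_(m, n)) i j :
  dotv (row i U) (row j U) = (U *m U^T) i j.
Proof. by rewrite mxE; apply: eq_bigr => k _; rewrite !mxE. Qed.

(** Representations are determined by the Gram entries on the diagonal and on
    the edges; the radius can be eliminated because [t] is a squared norm. *)
Lemma hypersphere_rep_dotP (R : realType) (T : finType) (e : rel T)
    (d : nat) (u : T -> 'rV[R]_d) (t : R) : (0 < #|T|)%N ->
  hypersphere_rep e u t <->
  [/\ (0 < d)%N, forall i, dotv (u i) (u i) = t &
      forall i j, e i j -> dotv (u i) (u j) = t - 1 / 2].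
Proof.
move=> /card_gt0P[i0 _]; split=> [[[d0 ue] [r [r0 ur ->]]] | [d0 ut ue]].
  have uu i : dotv (u i) (u i) = r ^+ 2 by rewrite -enorm_sqr ur.
  split=> // i j /ue/(congr1 (fun y => y ^+ 2)).
  rewrite enorm_sqr dotv_subsub !uu expr1n; lra.
split; first split=> // i j eij.
  by rewrite /enorm dotv_subsub !ut ue // -[RHS]sqrtr1; congr Num.sqrt; field.
exists (Num.sqrt t); split=> [|i|]; first exact: sqrtr_ge0.
  by rewrite /enorm ut.
by rewrite sqr_sqrtr // -(ut i0) -enorm_sqr sqr_ge0.
Qed.

(** Lift [u] to the unit sphere by adding the coordinate [sqrt (1 - 2 t)]
    after scaling by [sqrt 2], and test [x] along the new axis.  When
    [1 - 2 t <= 0] the lift is unavailable, but then the bound is trivial. *)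
Lemma TH_sum_bound (R : realType) (T : finType) (e : rel T)
    (d : nat) (u : T -> 'rV[R]_d) (t : R) (x : {ffun T -> R}) :
  (0 < #|T|)%N -> hypersphere_rep e u t -> TH (compl_graph e) x ->
  (1 - 2 * t) * \sum_i x i <= 1.
Proof.
move=> T0 /(hypersphere_rep_dotP _ _ _ T0)[d0 ut ue] [x_ge0 xTH].
have [t1|t1] := leP (1 - 2 * t) 0.
  by apply: le_trans ler01; rewrite mulr_le0_ge0 // sumr_ge0.
pose p i : 'rV[R]_(d + 1) :=
  row_mx (Num.sqrt 2 *: u i) (const_mx (Num.sqrt (1 - 2 * t))).
pose c : 'rV[R]_(d + 1) := row_mx 0 (const_mx 1).
have dotp i j : dotv (p i) (p j) = 2 * dotv (u i) (u j) + (1 - 2 * t).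
  rewrite dotv_row_mx dotvZ sqr_sqrtr // /dotv big_ord1 !mxE -expr2.
  by rewrite sqr_sqrtr // ltW.
have dotc i : dotv c (p i) ^+ 2 = 1 - 2 * t.
  rewrite dotv_row_mx {1}/dotv big1 ?add0r => [|k _]; last by rewrite mxE mul0r.
  by rewrite /dotv big_ord1 !mxE mul1r sqr_sqrtr // ltW.
have := xTH _ p c; under eq_bigr do rewrite dotc; rewrite -mulr_sumr; apply.
  split=> [|i|i j ij]; first by rewrite addn1.
    by rewrite /enorm dotp ut -[RHS]sqrtr1; congr Num.sqrt; ring.
  by rewrite /compl_graph /= ij negbK => eij; rewrite dotp ue //; field.
rewrite /enorm dotv_row_mx {1}/dotv big1 ?add0r => [|k _]; last first.
  by rewrite mxE mul0r.
by rewrite /dotv big_ord1 !mxE mulr1 sqrtr1.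
Qed.

(** * Weak duality with the theta number *)

(** A Gram matrix is a sum of rank-one terms, one for each coordinate [k], and
    pairing [X] with such a term is evaluating its quadratic form. *)
Lemma psd_dot_gram_ge0 (R : realType) (n d : nat) (X : 'M[R]_n)
    (a : 'I_n -> 'rV[R]_d) : psdmx X ->
  0 <= \sum_i \sum_j X i j * dotv (a i) (a j).
Proof.
move=> [_ Xpsd].
have -> : \sum_i \sum_j X i j * dotv (a i) (a j) =
    \sum_k ((\col_i a i 0 k)^T *m X *m \col_i a i 0 k) 0 0.
  under [RHS]eq_bigr do rewrite quad_formE.
  rewrite [RHS]exchange_big; apply: eq_bigr => i _ /=.
  rewrite [RHS]exchange_big; apply: eq_bigr => j _ /=.
  by rewrite /dotv mulr_sumr; apply: eq_bigr => k _; rewrite !mxE; ring.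
by apply: sumr_ge0 => k _; exact: Xpsd.
Qed.

Lemma ones_formE (R : realType) (n : nat) (X : 'M[R]_n) :
  ((ones R n)^T *m X *m ones R n) 0 0 = \sum_i \sum_j X i j.
Proof.
rewrite quad_formE; apply: eq_bigr => i _; apply: eq_bigr => j _.
by rewrite !mxE mul1r mulr1.
Qed.

(** The pairing [<X, a I - c J>], with [I] the identity and [J] the all-ones
    matrix; both duality arguments end in a matrix of this shape. *)
Lemma sum_mul_diag_const (R : realType) (n : nat) (X : 'M[R]_n) (a c : R) :
  \sum_i \sum_j X i j * (a * (i == j)%:R - c) =
  a * \tr X - c * ((ones R n)^T *m X *m ones R n) 0 0.
Proof.
rewrite ones_formE /mxtrace !mulr_sumr -sumrB; apply: eq_bigr => i _.
rewrite mulr_sumr (bigD1 i) //= [in RHS](bigD1 i) //= eqxx mulr1.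
rewrite opprD addrA; congr (_ + _); first by ring.
rewrite -sumrN; apply: eq_bigr => j /negbTE ji.
by rewrite eq_sym ji mulr0 sub0r mulrN mulrC.
Qed.

(** Where [X] may be nonzero, the Gram matrix of [u] agrees with
    [1/2 I - (1/2 - t) J]; its pairing with [X] is nonnegative. *)
Lemma theta_feasible_bound (R : realType) (T : finType) (e : rel T)
    (d : nat) (u : T -> 'rV[R]_d) (t s : R) :
  (0 < #|T|)%N -> hypersphere_rep e u t -> theta_values R (compl_graph e) s ->
  (1 - 2 * t) * s <= 1.
Proof.
move=> T0 /(hypersphere_rep_dotP _ _ _ T0)[d0 ut ue] [X [Xpsd trX X0] ->].
have := psd_dot_gram_ge0 (fun i => u (enum_val i)) Xpsd.
have -> : \sum_i \sum_j X i j * dotv (u (enum_val i)) (u (enum_val j)) =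
    \sum_i \sum_j X i j * (1 / 2 * (i == j)%:R - (1 / 2 - t)).
  apply: eq_bigr => i _; apply: eq_bigr => j _.
  have [<-|ij] := eqVneq i j; first by rewrite ut mulr1; congr (_ * _); ring.
  have [eij|Neij] := boolP (e (enum_val i) (enum_val j)).
    by rewrite ue // mulr0; congr (_ * _); ring.
  suff -> : X i j = 0 by rewrite !mul0r.
  rewrite -(enum_valK i) -(enum_valK j) X0 // /compl_graph /=.
  by rewrite (inj_eq enum_val_inj) ij.
rewrite sum_mul_diag_const trX; lra.
Qed.

(** * Strong duality with the theta number *)

(** Evaluate the quadratic form at the difference of two basis vectors. *)
Lemma psd_offdiag_le (R : realType) (n : nat) (X : 'M[R]_n) (i j : 'I_n) :
  psdmx X -> 2 * X i j <= X i i + X j j.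
Proof.
move=> [Xsym Xpsd].
have Xji : X j i = X i j by rewrite -[in LHS]Xsym mxE.
have := Xpsd (delta_mx i 0 - delta_mx j 0).
rewrite [(_ - _)^T]linearB /= !trmx_delta !mulmxBl !mulmxBr -!rowE -!colE !mxE.
rewrite Xji; lra.
Qed.

Lemma psd_diag_ge0 (R : realType) (n : nat) (X : 'M[R]_n) (i : 'I_n) :
  psdmx X -> 0 <= X i i.
Proof.
move=> [_ /(_ (delta_mx i 0))].
by rewrite trmx_delta -rowE -colE !mxE.
Qed.

Lemma psd_trace0_ones_le0 (R : realType) (n : nat) (X : 'M[R]_n) :
  psdmx X -> \tr X = 0 -> ((ones R n)^T *m X *m ones R n) 0 0 <= 0.
Proof.
move=> Xpsd trX.
have diag_ge0 i : 0 <= X i i by exact: psd_diag_ge0.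
have diag0 i : X i i = 0.
  apply/eqP; move/eqP: trX; rewrite psumr_eq0 // => /allP.
  by apply; exact: mem_index_enum.
rewrite ones_formE; apply: sumr_le0 => i _; apply: sumr_le0 => j _.
by have := psd_offdiag_le i j Xpsd; rewrite !diag0; lra.
Qed.

(** The theta number bounds the whole cone of feasible matrices, without
    normalizing the trace; for trace 0, the off-diagonal entries of [W] are
    nonpositive, so the left-hand side is too. *)
Lemma theta_homogeneous_bound (R : realType) (T : finType) (f : rel T)
    (W : 'M[R]_#|T|) : irreflexive f -> (0 < #|T|)%N -> psdmx W ->
  (forall i j, f i j -> W (enum_rank i) (enum_rank j) = 0) ->
  ((ones R #|T|)^T *m W *m ones R #|T|) 0 0 <= theta R f * \tr W.
Proof.
move=> firr T0 Wpsd W0.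
have trW_ge0 : 0 <= \tr W.
  by apply: sumr_ge0 => i _; exact: psd_diag_ge0.
have [trW0|trWN0] := eqVneq (\tr W) 0.
  by rewrite trW0 mulr0; exact: psd_trace0_ones_le0.
have trW_gt0 : 0 < \tr W by rewrite lt_def trWN0.
rewrite -ler_pdivrMr //; apply: ub_le_sup.
  by have [] := has_sup_theta_values R firr T0.
exists ((\tr W)^-1 *: W).
  have [Wsym Wge0] := Wpsd; split.
  - split=> [|v]; first by rewrite linearZ /= Wsym.
    by rewrite -scalemxAr -scalemxAl mxE mulr_ge0 // invr_ge0.
  - by rewrite mxtraceZ mulVf.
  - by move=> i j fij; rewrite mxE W0 // mulr0.
by rewrite -scalemxAr -scalemxAl [RHS]mxE mulrC.
Qed.

(** The identity matrix is a multiple of a feasible one. *)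
Lemma theta_ge1 (R : realType) (T : finType) (f : rel T) :
  irreflexive f -> (0 < #|T|)%N -> 1 <= theta R f.
Proof.
move=> firr T0; have n0 : 0 < (#|T|%:R : R) by rewrite ltr0n.
rewrite -(ler_pM2r n0) mul1r.
have <- : \tr (1%:M : 'M[R]_#|T|) = #|T|%:R by rewrite mxtrace1.
have {1}-> : \tr (1%:M : 'M[R]_#|T|) =
    ((ones R #|T|)^T *m 1%:M *m ones R #|T|) 0 0.
  rewrite mulmx1 mxE; apply: eq_bigr => i _.
  by rewrite !mxE eqxx mulr1.
apply: theta_homogeneous_bound => //.
  split=> [|v]; first exact: trmx1.
  by rewrite mulmx1 mxE; apply: sumr_ge0 => i _; rewrite mxE -expr2 sqr_ge0.
move=> i j fij; rewrite mxE (inj_eq enum_rank_inj).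
by case: eqP fij => // ->; rewrite firr.
Qed.

Lemma compl_graph_irr (T : finType) (e : rel T) : irreflexive (compl_graph e).
Proof. by move=> i; rewrite /compl_graph /= eqxx. Qed.

(** Complete [theta I - J], prescribed on the diagonal and on the edges, to a
    Gram matrix and divide by [2 theta]: the diagonal becomes
    [t = (1 - 1 / theta) / 2] and the edge entries [- 1 / (2 theta) = t - 1/2].
    If there were no completion, the separating [W] would contradict
    [theta_homogeneous_bound]. *)
Lemma optimal_hypersphere_rep (R : realType) (T : finType) (e : rel T) :
  symmetric e -> irreflexive e -> (0 < #|T|)%N ->
  exists2 t : R, hypersphere_sqradii R e t &
    2 * t + 1 / theta R (compl_graph e) = 1.
Proof.
move=> esym eirr T0; set th := theta R _.
have th_gt0 : 0 < th.
  by apply: lt_le_trans ltr01 _; apply: theta_ge1 => //; exact: compl_graph_irr.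
have thN0 : th != 0 by apply: lt0r_neq0.
pose S : rel 'I_#|T| := [rel a c | (a == c) || e (enum_val a) (enum_val c)].
pose b : 'M[R]_#|T| := \matrix_(a, c) (th * (a == c)%:R - 1).
have Ssym : symmetric S by move=> a c; rewrite /S /= eq_sym esym.
have Srefl : reflexive S by move=> a; rewrite /S /= eqxx.
have bsym : b^T = b by apply/matrixP => a c; rewrite !mxE eq_sym.
have [[U UE]|[W [Wpsd WS]]] :=
  psd_completion_alternative Ssym Srefl bsym; last first.
  have W1 : ((ones R #|T|)^T *m W *m ones R #|T|) 0 0 <= th * \tr W.
    apply: theta_homogeneous_bound => // [|i j /andP[ij Neij]].
      exact: compl_graph_irr.
    apply: WS.
    by rewrite /S /= (inj_eq enum_rank_inj) (negbTE ij) !enum_rankK.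
  under eq_bigr do under eq_bigr do rewrite mxE.
  by rewrite sum_mul_diag_const => ltW; exfalso; lra.
exists ((1 - 1 / th) / 2); last by field.
exists #|T|.+1, (fun i => Num.sqrt (2 * th)^-1 *: row (enum_rank i) U).
have dotu i j : S (enum_rank i) (enum_rank j) ->
    dotv (Num.sqrt (2 * th)^-1 *: row (enum_rank i) U)
         (Num.sqrt (2 * th)^-1 *: row (enum_rank j) U) =
    (2 * th)^-1 * (th * (i == j)%:R - 1).
  move=> Sij; rewrite dotvZ sqr_sqrtr ?invr_ge0; last by nra.
  by rewrite dotv_row UE // mxE (inj_eq enum_rank_inj).
apply/(hypersphere_rep_dotP _ _ _ T0); split=> // [i|i j eij].
  by rewrite dotu ?eqxx ?mulr1; [field | rewrite /S /= eqxx].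
rewrite dotu /S /= ?enum_rankK ?eij ?orbT //.
have -> : (i == j) = false by apply: contraTF eij => /eqP->; rewrite eirr.
by rewrite mulr0; field.
Qed.

(** * The inequality and its case of equality *)

Theorem proposition3p2 (R : realType) (T : finType) (e : rel T)
    (esym : symmetric e) (eirr : irreflexive e) (T0 : (0 < #|T|)%N)
    (d : nat) (u : T -> 'rV[R]_d) (t : R) (ut : hypersphere_rep e u t)
    (x : {ffun T -> R}) (xTH : TH (compl_graph e) x) (x0 : x <> 0) :
  1 <= 2 * t + 1 / \sum_(i : T) x i /\
  (2 * t + 1 / \sum_(i : T) x i = 1 <->
   t = hypersphere_number R e /\
   \sum_(i : T) x i = theta R (compl_graph e)).
Proof.
have firr := compl_graph_irr e.
have [x_ge0 _] := xTH; set s := \sum_i x i.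
have s_gt0 : 0 < s.
  rewrite lt_def sumr_ge0 // andbT; apply: contra_notN x0 => s0.
  apply/ffunP => i; rewrite ffunE; apply/eqP.
  by move: s0; rewrite psumr_eq0 // => /allP; apply; exact: mem_index_enum.
have weak t' : hypersphere_sqradii R e t' -> 1 - 2 * t' <= 1 / s.
  case=> d' [u' ut']; rewrite ler_pdivlMr //; exact: TH_sum_bound ut' xTH.
have t_in : hypersphere_sqradii R e t by exists d, u.
have [t1 t1_in t1E] := optimal_hypersphere_rep R esym eirr T0.
have th_gt0 : 0 < theta R (compl_graph e).
  by apply: lt_le_trans ltr01 _; exact: theta_ge1.
split; first by have := weak t t_in; lra.
split=> [tsE|[tE sE]].
  split.
    symmetry; apply: hypersphere_number_min => // t' /weak; lra.
  apply/eqP; rewrite eq_le; apply/andP; split.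
    (* compare with the optimal representation *)
    rewrite -ler_pV2 ?inE ?unitfE ?lt0r_neq0 //.
    by move: t1E (weak t1 t1_in); rewrite !div1r; lra.
  (* each theta value is at most [1 / (1 - 2 t)], which is [s] *)
  apply: ge_sup; first by have [] := has_sup_theta_values R firr T0.
  move=> v /(theta_feasible_bound T0 ut).
  have -> : 1 - 2 * t = s^-1 by move: tsE; rewrite div1r; lra.
  by rewrite mulrC ler_pdivrMr // mul1r.
have t_le : t <= t1.
  rewrite tE; apply: ge_inf => //.
  by have [_] := has_inf_hypersphere_sqradii R eirr T0.
by move: t1E (weak t t_in); rewrite -sE -/s; lra.
Qed.
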